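(* Let $\mathcal{C}$ be a super-modular category with minimal modular extensions $\check{\mathcal{C}}_\nu$, $\nu\in\mathbb{Z}/16$, with chiral central charges $c_\nu$, and let $\rho_{\bf g}:\mathcal{C}\to\mathcal{C}$ be an anti-unitary topological autoequivalence. Suppose $(\nu_1,\nu_2)$ is a pair for which there exists a map $\check{\rho}_{\bf g}:\check{\mathcal{C}}_{\nu_1}\to\check{\mathcal{C}}_{\nu_2}$ lifting $\rho_{\bf g}$. Then $$e^{2\pi i c_{\nu_2}/8}=e^{-2\pi i c_{\nu_1}/8}=e^{2\pi i (c_{\nu_1}+o_1({\bf g})/2)/8}$$ for some integer $o_1({\bf g})$. Moreover, if there are multiple pairs $(\nu_{i,1},\nu_{i,2})$ for which such a lift of $\rho_{\bf g}$ exists, then $e^{2\pi i c_{\nu_{i,2}}/8}=e^{-2\pi i c_{\nu_{i,1}}/8}=e^{2\pi i (c_{\nu_{i,1}}+o_1({\bf g})/2)/8}$, where the integer $o_1({\bf g})$ is independent of $i$ modulo $2$ (that is, the integers obtained from any two such pairs have the same parity).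
   Context: A super-modular category $\mathcal{C}$ is a unitary braided fusion category with exactly one nontrivial simple object $\psi$ that braids trivially with all objects, where $\psi$ is a fermion: topological twist $\theta_\psi=-1$ and $\psi\times\psi=1$. A minimal modular extension $\check{\mathcal{C}}$ of $\mathcal{C}$ is a UMTC containing $\mathcal{C}$ as a full braided fusion subcategory, with total quantum dimension satisfying $\mathcal{D}_{\check{\mathcal{C}}}^2=2\mathcal{D}_{\mathcal{C}}^2$. Every super-modular category has exactly 16 minimal modular extensions $\check{\mathcal{C}}_\nu$, $\nu\in\{0,\dots,15\}$, and their chiral central charges $c_\nu$ (defined mod 8 by the Gauss sum $\mathcal{D}^{-1}\sum_a d_a^2\theta_a=e^{2\pi i c_\nu/8}$) satisfy $c_\nu-c_{\nu'}=(\nu-\nu')/2 \bmod 8$. An anti-unitary topological autoequivalence is a braided anti-autoequivalence: up to a change of basis of fusion spaces, it complex conjugates the $F$- and $R$-symbols. A lift $\check{\rho}_{\bf g}:\check{\mathcal{C}}_{\nu_1}\to\check{\mathcal{C}}_{\nu_2}$ of an anti-unitary $\rho_{\bf g}$ is an anti-unitary braided equivalence from $\check{\mathcal{C}}_{\nu_1}$ to $\check{\mathcal{C}}_{\nu_2}$ (preserving fusion rules and quantum dimensions and complex conjugating twists) that restricts to (a representative of the class of) $\rho_{\bf g}$ on $\mathcal{C}$. *)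

(* Defs.v *)
From HB Require Import structures.
From mathcomp Require Import all_boot all_order all_algebra.
From mathcomp Require Import all_classical all_reals all_analysis.
From mathcomp Require Import complex.

Set Implicit Arguments.
Unset Strict Implicit.
Unset Printing Implicit Defensive.

Import Order.TTheory GRing.Theory Num.Theory.
Local Open Scope ring_scope.

(* Unitary braided fusion categories are given in skeletal form, by F- and    *)
(* R-symbols, over a field K standing for the complex numbers.  Simple        *)
(* objects are the elements of a finite type, and 'I_(fus a b c) indexes an   *)
(* orthonormal basis |a,b;c,mu> of Hom(c, a (x) b).  The symbols are          *)
(* determined by                                                              *)
(*   |a,b;e,al>|e,c;d,be> =                                                   *)
(*      \sum_(f,mu,nu) Fsym a b c d e f al be mu nu  |b,c;f,mu>|a,f;d,nu>     *)
(*   beta_(a,b) |a,b;c,mu> = \sum_nu Rsym a b c mu nu |b,a;c,nu>              *)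
(* where beta_(a,b) : a (x) b -> b (x) a is the braiding.                     *)
Record braiding_data (K : numClosedFieldType) := BraidingData {
  label : finType;
  one : label;
  dual : label -> label;
  fus : label -> label -> label -> nat;
  Fsym : forall a b c d e f : label,
    'I_(fus a b e) -> 'I_(fus e c d) -> 'I_(fus b c f) -> 'I_(fus a f d) -> K;
  Rsym : forall a b c : label, 'I_(fus a b c) -> 'I_(fus b a c) -> K }.

Arguments label {K} B : rename.
Arguments one {K} B : rename.
Arguments dual {K} B a : rename.
Arguments fus {K} B a b c : rename.
Arguments Fsym {K} B a b c d e f _ _ _ _ : rename.
Arguments Rsym {K} B a b c _ _ : rename.

Definition unitary_kernel (K : numClosedFieldType) (I J : finType)
    (M : I -> J -> K) : Prop :=
  (forall i i', \sum_j M i j * (M i' j)^* = (i == i')%:R) /\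
  (forall j j', \sum_i (M i j)^* * M i j' = (j == j')%:R).

Section Category.
Variables (K : numClosedFieldType) (B : braiding_data K).
Implicit Types a b c d e f g h k l x : label B.

Definition ltree a b c d : finType :=
  {e : label B & ('I_(fus B a b e) * 'I_(fus B e c d))%type}.

Definition rtree a b c d : finType :=
  {f : label B & ('I_(fus B b c f) * 'I_(fus B a f d))%type}.

Definition Fmx a b c d (x : ltree a b c d) (y : rtree a b c d) : K :=
  Fsym B a b c d (tag x) (tag y)
    (tagged x).1 (tagged x).2 (tagged y).1 (tagged y).2.

Definition pentagon : Prop :=
  forall a b c d e f g k l
    (al : 'I_(fus B a b f)) (be : 'I_(fus B f c g)) (ga : 'I_(fus B g d e))
    (de : 'I_(fus B c d l)) (la : 'I_(fus B b l k)) (mu : 'I_(fus B a k e)),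
  \sum_(nu < fus B f l e)
     Fsym B f c d e g l be ga de nu * Fsym B a b l e f k al nu la mu =
  \sum_h \sum_(si < fus B b c h) \sum_(ps < fus B a h g)
    \sum_(rh < fus B h d k)
     Fsym B a b c g f h al be si ps * Fsym B a h d e g k ps ga rh mu *
     Fsym B b c d k h l si rh de la.

Definition hexagon
    (Rs : forall a b c, 'I_(fus B a b c) -> 'I_(fus B b a c) -> K) : Prop :=
  forall a b c d e g
    (al : 'I_(fus B a b e)) (be : 'I_(fus B e c d))
    (si : 'I_(fus B c a g)) (ta : 'I_(fus B b g d)),
  \sum_(al' < fus B b a e) \sum_(si' < fus B a c g)
     Rs a b e al al' * Fsym B b a c d e g al' be si' ta * Rs a c g si' si =
  \sum_f \sum_(mu < fus B b c f) \sum_(nu < fus B a f d)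
    \sum_(nu' < fus B f a d)
     Fsym B a b c d e f al be mu nu * Rs a f d nu nu' *
     Fsym B b c a d f g mu nu' si ta.

(* The inverse braiding beta_(b,a)^-1, using that R is unitary. *)
Definition Rinv a b c (mu : 'I_(fus B a b c)) (nu : 'I_(fus B b a c)) : K :=
  (Rsym B b a c nu mu)^*.

(* fus_dual and rigid together say that dual a is a two-sided dual of a:      *)
(* F^(a dual(a) a)_a at (1, 1) is the zigzag composite, up to normalisation.  *)
Record unitary_braided_fusion : Prop := UnitaryBraidedFusion {
  fus_1l : forall a b, fus B (one B) a b = (a == b) :> nat;
  fus_1r : forall a b, fus B a (one B) b = (a == b) :> nat;
  fus_dual : forall a b, fus B a b (one B) = (b == dual B a) :> nat;
  F_unitary : forall a b c d, unitary_kernel (@Fmx a b c d);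
  F_1l : forall b c d al be mu nu,
    Fsym B (one B) b c d b d al be mu nu = (be == mu)%:R;
  F_1m : forall a c d al be mu nu,
    Fsym B a (one B) c d a c al be mu nu = (be == nu)%:R;
  F_1r : forall a b d al be mu nu,
    Fsym B a b (one B) d d b al be mu nu = (al == nu)%:R;
  F_pentagon : pentagon;
  rigid : forall a al be mu nu,
    Fsym B a (dual B a) a a (one B) (one B) al be mu nu != 0;
  R_unitary : forall a b c, unitary_kernel (Rsym B a b c);
  R_hexagon : hexagon (Rsym B);
  R_hexagon_inv : hexagon Rinv }.

(* d_a = 1 / |F^(a dual(a) a)_a at (1, 1)|; in a unitary braided fusion       *)
(* category the four fusion spaces are lines, so the sum has a single term.   *)
Definition qdim a : K :=
  `| \sum_al \sum_be \sum_mu \sum_nu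
       Fsym B a (dual B a) a a (one B) (one B) al be mu nu |^-1.

Definition total_qdim : K := sqrtC (\sum_a qdim a ^+ 2).

(* theta_a d_a is the quantum trace of beta_(a,a). *)
Definition twist a : K :=
  (qdim a)^-1 * \sum_c qdim c * \sum_(mu < fus B a a c) Rsym B a a c mu mu.

Definition gauss_sum : K :=
  total_qdim^-1 * \sum_a qdim a ^+ 2 * twist a.

Definition monodromy a b c (mu mu' : 'I_(fus B a b c)) : K :=
  \sum_(nu < fus B b a c) Rsym B a b c mu nu * Rsym B b a c nu mu'.

Definition transparent x : Prop :=
  forall b c (mu mu' : 'I_(fus B x b c)), monodromy mu mu' = (mu == mu')%:R.

(* Unnormalised: the quantum trace of the double braiding of a and b. *)
Definition Smatrix : 'M[K]_#|label B| :=
  \matrix_(i, j) \sum_c qdim c *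
    \sum_(mu < fus B (enum_val i) (enum_val j) c) monodromy mu mu.

Definition umtc : Prop :=
  unitary_braided_fusion /\ Smatrix \in unitmx.

Definition super_modular : Prop :=
  unitary_braided_fusion /\
  exists psi : label B,
    [/\ forall x, transparent x <-> (x = one B \/ x = psi),
        psi != one B,
        twist psi = -1 &
        forall c, fus B psi psi c = (c == one B) :> nat].

End Category.

(* Conjugation when s = true (anti-unitary), identity when s = false. *)
Definition twconj (K : numClosedFieldType) (s : bool) (z : K) : K :=
  if s then z^* else z.

(* A (possibly anti-linear) functor sending simple objects to simple objects: *)
(* |a,b;c,mu> is sent to                                                      *)
(*   \sum_mu' fsym f a b c mu mu' |f a, f b; f c, mu'>.                       *)
Record functor_data (K : numClosedFieldType) (B B' : braiding_data K) :=
  FunctorData {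
  flabel :> label B -> label B';
  fsym : forall a b c,
    'I_(fus B a b c) -> 'I_(fus B' (flabel a) (flabel b) (flabel c)) -> K }.

Arguments fsym {K B B'} f a b c _ _ : rename.

Section Functors.
Variable K : numClosedFieldType.
Implicit Types B : braiding_data K.

(* A unitary (s = false) or anti-unitary (s = true) braided equivalence onto  *)
(* a full fusion subcategory of B'.                                           *)
Record braided_embedding (s : bool) B B' (f : functor_data B B') : Prop :=
  BraidedEmbedding {
  emb_inj : injective f;
  emb_one : f (one B) = one B';
  emb_closed : forall a b c', (0 < fus B' (f a) (f b) c')%N ->
    exists c, c' = f c;
  emb_unitary : forall a b c, unitary_kernel (fsym f a b c);
  emb_F : forall a b c d e e'
      (al : 'I_(fus B a b e)) (be : 'I_(fus B e c d))
      (mu' : 'I_(fus B' (f b) (f c) (f e')))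
      (nu' : 'I_(fus B' (f a) (f e') (f d))),
    \sum_al' \sum_be' fsym f a b e al al' * fsym f e c d be be' *
       Fsym B' (f a) (f b) (f c) (f d) (f e) (f e') al' be' mu' nu' =
    \sum_mu \sum_nu twconj s (Fsym B a b c d e e' al be mu nu) *
       fsym f b c e' mu mu' * fsym f a e' d nu nu';
  emb_R : forall a b c (mu : 'I_(fus B a b c))
      (nu' : 'I_(fus B' (f b) (f a) (f c))),
    \sum_mu' fsym f a b c mu mu' * Rsym B' (f a) (f b) (f c) mu' nu' =
    \sum_nu twconj s (Rsym B a b c mu nu) * fsym f b a c nu nu' }.

Definition braided_equivalence (s : bool) B B' (f : functor_data B B') : Prop :=
  braided_embedding s f /\ bijective f.

(* The composite "g after f", where s tells whether g is anti-linear. *)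
Definition functor_comp (s : bool) B B' B''
    (g : functor_data B' B'') (f : functor_data B B') : functor_data B B'' :=
  {| flabel := fun a => g (f a);
     fsym := fun a b c mu mu'' =>
       \sum_mu' twconj s (fsym f a b c mu mu') *
                fsym g (f a) (f b) (f c) mu' mu'' |}.

(* Unitary monoidal natural isomorphism, with components the phases ga.  The  *)
(* bases of the two target fusion spaces, which are equal because f =1 g, are *)
(* matched through the underlying naturals of their indices.                  *)
Definition nat_isomorphic B B' (f g : functor_data B B') : Prop :=
  f =1 g /\
  exists2 ga : label B -> K, (forall a, `|ga a| = 1) &
    forall a b c (mu : 'I_(fus B a b c))
      (i : 'I_(fus B' (f a) (f b) (f c))) (j : 'I_(fus B' (g a) (g b) (g c))),
      i = j :> nat ->
      ga a * ga b * fsym f a b c mu i = ga c * fsym g a b c mu j.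

Record min_mod_ext B := MinModExt {
  ext :> braiding_data K;
  ext_incl : functor_data B ext;
  ext_umtc : umtc ext;
  ext_embedding : braided_embedding false ext_incl;
  ext_dim : total_qdim ext ^+ 2 = 2 * total_qdim B ^+ 2 }.

Definition ext_equivalent B (E E' : min_mod_ext B) : Prop :=
  exists2 f : functor_data E E', braided_equivalence false f &
    nat_isomorphic (functor_comp false f (ext_incl E)) (ext_incl E').

Definition antiunitary_lift B (E E' : min_mod_ext B) (rho : functor_data B B)
    (f : functor_data E E') : Prop :=
  braided_equivalence true f /\
  nat_isomorphic (functor_comp true f (ext_incl E))
                 (functor_comp false (ext_incl E') rho).

Definition has_lift B (rho : functor_data B B) (E E' : min_mod_ext B) : Prop :=
  exists f : functor_data E E', antiunitary_lift rho f.

(* E lists the minimal modular extensions of B, each exactly once. *)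
Definition enumerates_extensions B (I : Type) (E : I -> min_mod_ext B) : Prop :=
  (forall M : min_mod_ext B, exists i, ext_equivalent M (E i)) /\
  (forall i j, ext_equivalent (E i) (E j) -> i = j).

End Functors.

Section CentralCharge.
Variable R : realType.

(* e^(2 pi i x / 8) *)
Definition cis8 (x : R) : R[i]%C :=
  (cos (2 * pi * x / 8) +i* sin (2 * pi * x / 8))%C.

Definition is_central_charge (B : braiding_data R[i]%C) (c : R) : Prop :=
  gauss_sum B = cis8 c.

Definition eq_mod8 (x y : R) : Prop := exists k : int, x = y + 8 * k%:~R.

End CentralCharge.

(* Main.v *)
(* An anti-unitary equivalence preserves quantum dimensions and conjugates    *)
(* twists, hence conjugates the Gauss sum: c_nu2 = - c_nu1 mod 8, and o_1 can *)
(* be taken to be nu2 - nu1.  Any o_1 solves o_1 / 2 = - 2 c_nu1 mod 8, so a  *)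
(* second pair changes it by an even integer, because c_nu11 - c_nu21 is an   *)
(* integer multiple of 1/2 mod 8.                                             *)

Require Import Defs.
From HB Require Import structures.
From mathcomp Require Import all_boot all_order all_algebra.
From mathcomp Require Import all_classical all_reals all_analysis.
From mathcomp Require Import complex.
From mathcomp Require Import ring zify.

Set Implicit Arguments.
Unset Strict Implicit.
Unset Printing Implicit Defensive.

Import Order.TTheory GRing.Theory Num.Theory.
Local Open Scope ring_scope.

(** A braided equivalence changes the bases of fusion spaces by unitary matrices, so quantities
    insensitive to such changes are carried over, up to conjugation. The quantum dimension is the
    inverse norm of one F-entry on lines, where a basis change is a phase ([emb_qdim]). The twist is
    built from traces of R-matrices, which are invariant under unitary conjugation ([emb_trace_R]).
    Summing over simple objects gives [equiv_gauss_sum], whence the relation between central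
    charges. For parity, o_1 = - 4 c_nu1 mod 16. Two central charges differ by m/2 mod 8 with m an
    integer, so two values of o_1 differ by - 2 m mod 16; [cis8_half_even] extracts the parity. *)

Section Equivalence.
Variable K : numClosedFieldType.

(** Count the sum of all |M i j|^2 by rows and by columns. *)
Lemma unitary_kernel_card (I J : finType) (M : I -> J -> K) :
  unitary_kernel M -> #|I| = #|J|.
Proof.
move=> [hr hc]; apply/eqP; rewrite -(eqr_nat K); apply/eqP.
transitivity (\sum_i \sum_j M i j * (M i j)^*).
  by under eq_bigr do rewrite hr eqxx; rewrite sumr_const.
rewrite exchange_big /=.
under eq_bigr do [under eq_bigr do rewrite mulrC; rewrite hc eqxx].
by rewrite sumr_const.
Qed.

Lemma sum_line (I : finType) (F : I -> K) (i : I) :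
  #|I| = 1%N -> \sum_j F j = F i.
Proof.
move=> /eqP/fintype1P [x hx]; rewrite (bigD1 i) //= big1 ?addr0 // => j.
by rewrite !hx eqxx.
Qed.

Lemma unitary_kernel_norm1 (I J : finType) (M : I -> J -> K) (i : I) (j : J) :
  unitary_kernel M -> #|J| = 1%N -> `|M i j| = 1.
Proof.
move=> [hr _] J1; apply/eqP; rewrite -sqrp_eq1 ?normr_ge0 // normCK.
by rewrite -(sum_line (fun j => M i j * (M i j)^*) j J1) hr eqxx.
Qed.

(** In matrix form M A' = A M, so A' = M^* A M, and the trace is cyclic. *)
Lemma unitary_kernel_trace (I J : finType) (M : I -> J -> K)
    (A : I -> I -> K) (A' : J -> J -> K) :
  unitary_kernel M ->
  (forall i j, \sum_k M i k * A' k j = \sum_k A i k * M k j) ->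
  \sum_j A' j j = \sum_i A i i.
Proof.
move=> [hr hc] hA.
transitivity (\sum_j \sum_k (\sum_i (M i j)^* * M i k) * A' k j).
  apply: eq_bigr => j _; rewrite (bigD1 j) //= hc eqxx mul1r big1 ?addr0 //.
  by move=> k kj; rewrite hc eq_sym (negbTE kj) mul0r.
transitivity (\sum_i \sum_k A i k * \sum_j M k j * (M i j)^*); last first.
  apply: eq_bigr => i _; rewrite (bigD1 i) //= hr eqxx mulr1 big1 ?addr0 //.
  by move=> k ki; rewrite hr (negbTE ki) mulr0.
transitivity (\sum_j \sum_i (M i j)^* * \sum_k M i k * A' k j).
  apply: eq_bigr => j _; under eq_bigr do rewrite mulr_suml.
  rewrite exchange_big; apply: eq_bigr => i _ /=.
  by rewrite mulr_sumr; apply: eq_bigr => k _; rewrite mulrA.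
rewrite exchange_big; apply: eq_bigr => i _ /=.
under eq_bigr do rewrite hA mulr_sumr.
rewrite exchange_big; apply: eq_bigr => k _ /=.
by rewrite mulr_sumr; apply: eq_bigr => j _; rewrite mulrCA [_^* * _]mulrC.
Qed.

Lemma norm_twconj s (z : K) : `|twconj s z| = `|z|.
Proof. by case: s; rewrite //= norm_conjC. Qed.

Lemma twconjM s : {morph @twconj K s : x y / x * y}.
Proof. by case: s => x y; rewrite //= rmorphM. Qed.

Lemma twconj_sum s (I : finType) (F : I -> K) :
  twconj s (\sum_i F i) = \sum_i twconj s (F i).
Proof. by case: s; rewrite //= rmorph_sum. Qed.

Lemma twconj_ge0 s (z : K) : 0 <= z -> twconj s z = z.
Proof. by case: s => //= z0; apply/CrealP/ger0_real. Qed.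

Lemma qdim_ge0 (B : braiding_data K) (a : label B) : 0 <= qdim a.
Proof. by rewrite invr_ge0 normr_ge0. Qed.

Lemma total_qdim_ge0 (B : braiding_data K) : 0 <= total_qdim B.
Proof. by rewrite sqrtC_ge0 sumr_ge0 // => a _; rewrite exprn_ge0 ?qdim_ge0. Qed.

(** The index types of [Fsym] depend on the labels; with the dual and the unit as variables, the
    image labels can be substituted in one rewrite. *)
Lemma qdimE (B : braiding_data K) (a b o : label B) :
  b = Defs.dual B a -> o = Defs.one B ->
  qdim a = `| \sum_al \sum_be \sum_mu \sum_nu Fsym B a b a a o o al be mu nu |^-1.
Proof. by move=> -> ->. Qed.

Variables (s : bool) (B B' : braiding_data K) (f : functor_data B B').

Section Embedding.
Hypotheses (hB : unitary_braided_fusion B) (hB' : unitary_braided_fusion B').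
Hypothesis hf : braided_embedding s f.

Lemma emb_fus a b c : fus B' (f a) (f b) (f c) = fus B a b c.
Proof.
by have /unitary_kernel_card := emb_unitary hf a b c; rewrite !card_ord.
Qed.

(** The dual is characterised by fusing with a to the unit, and multiplicities are preserved. *)
Lemma emb_dual a : f (Defs.dual B a) = Defs.dual B' (f a).
Proof.
apply/eqP; have := fus_dual hB' (f a) (f (Defs.dual B a)).
by rewrite -(emb_one hf) emb_fus (fus_dual hB) eqxx; case: eqP.
Qed.

Lemma emb_qdim a : qdim (f a) = qdim a.
Proof.
rewrite (qdimE (emb_dual a) (emb_one hf)) (qdimE erefl erefl); congr _^-1.
(* dual (dual a) = a is not an axiom, so the case of a zero space is treated  *)
(* separately: there both quantum dimensions have the junk value 0^-1.        *)
have fus1 : fus B (Defs.dual B a) a (Defs.one B) = 0%N \/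
            fus B (Defs.dual B a) a (Defs.one B) = 1%N.
  by rewrite (fus_dual hB); case: eqP; [right | left].
have [fus0 | {}fus1] := fus1.
  have fus0' : fus B' (f (Defs.dual B a)) (f a) (f (Defs.one B)) = 0%N.
    by rewrite emb_fus.
  have sum0 n (F : 'I_n -> K) : n = 0%N -> \sum_i F i = 0.
    by move=> n0; rewrite big1 // => -[m ltm] _; exfalso; rewrite n0 in ltm.
  congr `|_|; transitivity (0 : K); last apply: esym.
    by rewrite big1 // => al _; rewrite big1 // => be _; rewrite sum0.
  by rewrite big1 // => al _; rewrite big1 // => be _; rewrite sum0.
have card1 b c d : fus B b c d = 1%N -> #|'I_(fus B b c d)| = 1%N.
  by rewrite card_ord.
have card1' b c d : fus B b c d = 1%N -> #|'I_(fus B' (f b) (f c) (f d))| = 1%N.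
  by rewrite card_ord emb_fus.
have pt b c d : fus B b c d = 1%N -> 'I_(fus B b c d).
  by move=> e; rewrite e; exact: ord0.
have pt' b c d : fus B b c d = 1%N -> 'I_(fus B' (f b) (f c) (f d)).
  by move=> e; rewrite emb_fus e; exact: ord0.
have e1 : fus B a (Defs.dual B a) (Defs.one B) = 1%N.
  by rewrite (fus_dual hB) eqxx.
have e2 : fus B (Defs.one B) a a = 1%N by rewrite (fus_1l hB) eqxx.
have e3 : fus B a (Defs.one B) a = 1%N by rewrite (fus_1r hB) eqxx.
rewrite (sum_line _ (pt _ _ _ e1) (card1 _ _ _ e1)).
rewrite (sum_line _ (pt _ _ _ e2) (card1 _ _ _ e2)).
rewrite (sum_line _ (pt _ _ _ fus1) (card1 _ _ _ fus1)).
rewrite (sum_line _ (pt _ _ _ e3) (card1 _ _ _ e3)).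
rewrite (sum_line _ (pt' _ _ _ e1) (card1' _ _ _ e1)).
rewrite (sum_line _ (pt' _ _ _ e2) (card1' _ _ _ e2)).
rewrite (sum_line _ (pt' _ _ _ fus1) (card1' _ _ _ fus1)).
rewrite (sum_line _ (pt' _ _ _ e3) (card1' _ _ _ e3)).
(* On lines this compatibility equates the two F-entries up to conjugation and four phases, all
   invisible to the norm. *)
have := emb_F hf (pt _ _ _ e1) (pt _ _ _ e2) (pt' _ _ _ fus1) (pt' _ _ _ e3).
rewrite (sum_line _ (pt' _ _ _ e1) (card1' _ _ _ e1)).
rewrite (sum_line _ (pt' _ _ _ e2) (card1' _ _ _ e2)).
rewrite (sum_line _ (pt _ _ _ fus1) (card1 _ _ _ fus1)).
rewrite (sum_line _ (pt _ _ _ e3) (card1 _ _ _ e3)).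
move=> /(congr1 Num.norm); rewrite !normrM norm_twconj.
by rewrite !(unitary_kernel_norm1 _ _ (emb_unitary hf _ _ _)) ?card1' // !mul1r !mulr1.
Qed.

Lemma emb_trace_R a c :
  \sum_mu Rsym B' (f a) (f a) (f c) mu mu =
  twconj s (\sum_mu Rsym B a a c mu mu).
Proof.
rewrite twconj_sum.
exact: (unitary_kernel_trace (A := fun mu nu => twconj s (Rsym B a a c mu nu))
  (A' := Rsym B' _ _ _) (emb_unitary hf a a c) (emb_R hf (c := c))).
Qed.

End Embedding.

Hypotheses (hB : unitary_braided_fusion B) (hB' : unitary_braided_fusion B').
Hypothesis hf : braided_equivalence s f.
Let femb : braided_embedding s f := hf.1.

(** Here bijectivity on simple objects enters: dimensions and Gauss sums run over all of them. *)
Lemma equiv_sum (F : label B' -> K) : \sum_a F a = \sum_a F (f a).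
Proof. by rewrite (reindex f) //; apply: onW_bij; exact: hf.2. Qed.

Lemma equiv_total_qdim : total_qdim B' = total_qdim B.
Proof.
rewrite /total_qdim equiv_sum; congr sqrtC.
by apply: eq_bigr => a _; rewrite (emb_qdim hB hB' femb).
Qed.

Lemma equiv_twist a : twist (f a) = twconj s (twist a).
Proof.
rewrite /twist equiv_sum twconjM twconj_sum (emb_qdim hB hB' femb).
rewrite [twconj s _^-1]twconj_ge0 ?invr_ge0 ?qdim_ge0 //; congr (_ * _).
apply: eq_bigr => c _.
rewrite (emb_trace_R femb) (emb_qdim hB hB' femb) twconjM.
by rewrite [twconj s (qdim _)]twconj_ge0 ?qdim_ge0.
Qed.

Lemma equiv_gauss_sum : gauss_sum B' = twconj s (gauss_sum B).
Proof.
rewrite /gauss_sum equiv_sum equiv_total_qdim twconjM twconj_sum.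
rewrite [twconj s _^-1]twconj_ge0 ?invr_ge0 ?total_qdim_ge0 //; congr (_ * _).
apply: eq_bigr => a _; rewrite equiv_twist (emb_qdim hB hB' femb) twconjM.
by rewrite [twconj s (_ ^+ _)]twconj_ge0 ?exprn_ge0 ?qdim_ge0.
Qed.

End Equivalence.

(** * Phases of central charges modulo 8 *)

Section CentralCharge.
Variable R : realType.
Implicit Types x y : R.

Lemma cis8D x y : cis8 (x + y) = cis8 x * cis8 y.
Proof.
rewrite /cis8 mulrDr mulrDl cosD sinD.
by apply/eqP; rewrite eq_complex /= [X in _ && (_ == X)]addrC !eqxx.
Qed.

Lemma cis8N x : cis8 (- x) = (cis8 x)^*.
Proof. by rewrite /cis8 mulrN mulNr cosN sinN. Qed.

Lemma cis8_0 : cis8 (0 : R) = 1.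
Proof. by rewrite /cis8 mulr0 mul0r cos0 sin0. Qed.

Lemma cis8_unit x : cis8 x * cis8 (- x) = 1.
Proof. by rewrite -cis8D subrr cis8_0. Qed.

Lemma cis8Mn x n : cis8 (x *+ n) = cis8 x ^+ n.
Proof. by elim: n => [|n IH]; rewrite ?cis8_0 // mulrS cis8D IH exprS. Qed.

Lemma cis8_4 : cis8 (4 : R) = -1.
Proof.
have -> : cis8 (4 : R) = (cos (pi : R) +i* sin pi)%C.
  by rewrite /cis8; have -> : 2 * pi * 4 / 8 = pi :> R by field.
by rewrite cospi sinpi; apply/eqP; rewrite eq_complex /= oppr0 !eqxx.
Qed.

Lemma cis8_period (k : int) : cis8 (8 * k%:~R : R) = 1.
Proof.
have h n : cis8 (8 * n%:R : R) = 1.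
  rewrite mulr_natr cis8Mn (_ : 8 = 4 + 4 :> R); last by ring.
  by rewrite cis8D cis8_4 mulrNN mulr1 expr1n.
case: k => n; first exact: h.
by rewrite NegzE mulrNz mulrN cis8N h rmorph1.
Qed.

Lemma eq_mod8_cis8 x y : eq_mod8 x y -> cis8 x = cis8 y.
Proof. by move=> [k ->]; rewrite cis8D cis8_period mulr1. Qed.

(** The eighth power of this 16th root of unity is (-1)^n. *)
Lemma cis8_half_even (n : int) : cis8 (n%:~R / 2 : R) = 1 -> (2 %| n)%Z.
Proof.
move=> h; have : cis8 (4 * n%:~R : R) = 1.
  have -> : 4 * n%:~R = (n%:~R / 2) *+ 8 :> R by rewrite -mulr_natr; field.
  by rewrite cis8Mn h expr1n.
suff -> : cis8 (4 * n%:~R : R) = (-1) ^+ `|n|%N.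
  rewrite -signr_odd dvdzE /= dvdn2; case: (odd _) => //= /esym/eqP.
  by rewrite expr1 -addr_eq0 -mulr2n pnatr_eq0.
have hm m : cis8 (4 * m%:R : R) = (-1) ^+ m by rewrite mulr_natr cis8Mn cis8_4.
case: n {h} => m; first exact: hm.
by rewrite NegzE mulrNz mulrN cis8N hm rmorphXn rmorphN1 abszN.
Qed.

End CentralCharge.

Theorem theoremI3 (R : realType) (C : braiding_data R[i]%C)
    (hC : super_modular C)
    (E : 'Z_16 -> min_mod_ext C) (hE : enumerates_extensions E)
    (c : 'Z_16 -> R) (hc : forall nu, is_central_charge (E nu) (c nu))
    (hc16 : forall nu nu' : 'Z_16,
       eq_mod8 (c nu - c nu') (((nu : nat)%:R - (nu' : nat)%:R) / 2))
    (rho : functor_data C C) (hrho : braided_equivalence true rho) :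
  (forall nu1 nu2 : 'Z_16, has_lift rho (E nu1) (E nu2) ->
     cis8 (c nu2) = cis8 (- c nu1) /\
     exists o1 : int, cis8 (- c nu1) = cis8 (c nu1 + o1%:~R / 2)) /\
  (forall nu11 nu12 nu21 nu22 : 'Z_16,
     has_lift rho (E nu11) (E nu12) -> has_lift rho (E nu21) (E nu22) ->
     forall o1 o1' : int,
       cis8 (- c nu11) = cis8 (c nu11 + o1%:~R / 2) ->
       cis8 (- c nu21) = cis8 (c nu21 + o1'%:~R / 2) ->
       (o1 = o1' %[mod 2])%Z).
Proof.
split.
  move=> nu1 nu2 [f [hf _]].
  have h2 : cis8 (c nu2) = cis8 (- c nu1).
    rewrite cis8N -(hc nu1) -(hc nu2).
    exact: (equiv_gauss_sum (ext_umtc (E nu1)).1 (ext_umtc (E nu2)).1 hf).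
  (* By [hc16], c_nu2 - c_nu1 is half of this witness mod 8. *)
  split=> //; exists ((nu2 : nat)%:Z - (nu1 : nat)%:Z).
  rewrite -h2 intrB cis8D -(eq_mod8_cis8 (hc16 nu2 nu1)).
  by rewrite -cis8D addrC subrK.
move=> n1 _ n2 _ _ _ o1 o1' h1 h2.
apply/eqP; rewrite eqz_mod_dvd.
have hd := eq_mod8_cis8 (hc16 n1 n2).
pose m : int := (n1 : nat)%:Z - (n2 : nat)%:Z.
have {}hd : cis8 (c n1 - c n2) = cis8 (m%:~R / 2) by rewrite hd /m intrB.
(* The even shift 2 m cancels the change of - 4 c between the two pairs. *)
suff : cis8 ((o1 - o1' + m *+ 2)%:~R / 2 : R) = 1.
  by move/cis8_half_even; lia.
have -> : (o1 - o1' + m *+ 2)%:~R / 2 =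
    o1%:~R / 2 + - (o1'%:~R / 2) + (m%:~R / 2 + m%:~R / 2) :> R.
  by rewrite !rmorphD /= rmorphN /=; field.
rewrite 2!cis8D [cis8 (m%:~R / 2 + _)]cis8D -hd -!cis8D.
(* The equation for o_1 as 2 c + o_1 / 2 = 0 mod 8; the goal is the difference of two such
   relations. *)
have h z w : cis8 (- z) = cis8 (z + w) -> cis8 (z *+ 2 + w) = 1 :> R[i]%C.
  by move=> e; rewrite mulr2n -addrA cis8D -e cis8_unit.
rewrite (_ : _ + _ = (c n1 *+ 2 + o1%:~R / 2) - (c n2 *+ 2 + o1'%:~R / 2)).
  by rewrite cis8D cis8N !h // mul1r rmorph1.
by ring.
Qed.
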